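(* Let $G$ be a finite simple graph with edge ideal $I(G)$ and induced matching number $\operatorname{ind-match}(G)$. Then for every integer $s$ with $1\leq s\leq \operatorname{ind-match}(G)$, we have $$\operatorname{reg}(I(G)^{\{s\}})\geq s+\operatorname{ind-match}(G).$$
   Context: Let $\mathbb{K}$ be a field and let $G$ be a finite simple graph with vertex set $\{x_1,\ldots,x_n\}$; vertices are identified with the variables of $S=\mathbb{K}[x_1,\ldots,x_n]$. The edge ideal is $I(G)=(x_ix_j : x_ix_j\in E(G))\subseteq S$. For a squarefree monomial ideal $I$ with irredundant primary decomposition $I=\mathfrak{p}_1\cap\cdots\cap\mathfrak{p}_r$ (each $\mathfrak{p}_i$ generated by variables), the $s$-th symbolic power ($s\ge 1$) is $I^{(s)}=\mathfrak{p}_1^s\cap\cdots\cap\mathfrak{p}_r^s$. The squarefree part of a monomial ideal is the ideal generated by all squarefree monomials in it; $I^{\{s\}}$ denotes the squarefree part of $I^{(s)}$. For a graded $S$-module $M$ with graded Betti numbers $\beta_{i,j}(M)$, $\operatorname{reg}(M)=\max\{j-i : \beta_{i,j}(M)\neq 0\}$ (here $I(G)^{\{s\}}$ is regarded as a graded $S$-module). A matching is a set of pairwise disjoint edges; a matching $M$ is an induced matching if for every pair of edges $e,e'\in M$ there is no edge $f\in E(G)\setminus M$ with $f\subset e\cup e'$. $\operatorname{ind-match}(G)$ is the maximum cardinality of an induced matching of $G$. *)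

(* Defs.v *)
From HB Require Import structures.
From mathcomp Require Import all_boot all_order all_algebra.
From mathcomp Require Import mpoly.

Set Implicit Arguments.
Unset Strict Implicit.
Unset Printing Implicit Defensive.

Import Order.TTheory GRing.Theory Num.Theory.
Local Open Scope ring_scope.

(* A simple graph on the vertices x_0, ..., x_(n-1) is a symmetric irreflexive
   relation e on 'I_n; vertex i is identified with the variable 'X_i of
   {mpoly K[n]}.  Ideals of {mpoly K[n]} are represented by their membership
   predicates. *)

Section Graph.
Variables (n : nat) (e : rel 'I_n).

Definition edge_set : {set {set 'I_n}} :=
  [set f | [exists i, [exists j, e i j && (f == [set i; j])]]].

Definition matching (M : {set {set 'I_n}}) : bool :=
  (M \subset edge_set) && trivIset M.

Definition induced_matching (M : {set {set 'I_n}}) : bool :=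
  matching M &&
  [forall a in M, forall b in M, forall f in edge_set :\: M,
     ~~ (f \subset a :|: b)].

Definition ind_match : nat := \max_(M | induced_matching M) #|M|.

End Graph.

Section Ideals.
Variables (K : fieldType) (n : nat).
Local Notation S := {mpoly K[n]}.

Definition gen_ideal (A : S -> Prop) : S -> Prop := fun p =>
  exists (k : nat) (a g : 'I_k -> S),
    (forall i, A (g i)) /\ p = \sum_(i < k) a i * g i.

Definition ideal_pow (I : S -> Prop) (s : nat) : S -> Prop :=
  gen_ideal (fun p =>
    exists f : 'I_s -> S, (forall i, I (f i)) /\ p = \prod_(i < s) f i).

Definition edge_ideal (e : rel 'I_n) : S -> Prop :=
  gen_ideal (fun p => exists i j, e i j /\ p = 'X_i * 'X_j).

Definition var_ideal (C : {set 'I_n}) : S -> Prop :=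
  gen_ideal (fun p => exists2 i, i \in C & p = 'X_i).

Definition is_intersection (I : S -> Prop) (P : {set {set 'I_n}}) : Prop :=
  forall p, I p <-> (forall C, C \in P -> var_ideal C p).

Definition irredundant_primary_decomposition
    (I : S -> Prop) (P : {set {set 'I_n}}) : Prop :=
  is_intersection I P /\
  (forall C, C \in P -> ~ is_intersection I (P :\ C)).

(* A squarefree monomial ideal I has exactly one irredundant primary
   decomposition, so the quantifier over P below ranges over one family. *)
Definition symbolic_power (I : S -> Prop) (s : nat) : S -> Prop := fun p =>
  forall P, irredundant_primary_decomposition I P ->
  forall C, C \in P -> ideal_pow (var_ideal C) s p.

Definition squarefree_part (I : S -> Prop) : S -> Prop :=
  gen_ideal (fun p => exists m : 'X_{1..n},
    [/\ forall i, (m i <= 1)%N, p = 'X_[m] & I p]).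

(* The data of a complex of graded free modules with an augmentation to S:
   F_i is the module of row vectors 'rV[S]_(rk i), its k-th basis vector has
   degree deg i k (so F_i is the direct sum of the S(- deg i k)), the
   differential F_(i+1) -> F_i is v |-> v *m diff i, and F_0 -> S is
   v |-> v *m aug. *)
Record free_complex := FreeComplex {
  rk : nat -> nat;
  deg : forall i, 'I_(rk i) -> int;
  diff : forall i, 'M[S]_(rk i.+1, rk i);
  aug : 'cV[S]_(rk 0)
}.

(* The map v |-> v *m A preserves degrees when the basis vectors of its source
   and target have degrees a and b. *)
Definition degree_preserving (k l : nat) (a : 'I_k -> int) (b : 'I_l -> int)
    (A : 'M[S]_(k, l)) : Prop :=
  forall i j (m : 'X_{1..n}), m \in msupp (A i j) -> (mdeg m)%:Z + b j = a i.

(* I is regarded as a graded S-module (F_0 maps onto I, not onto S / I), and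
   minimality means that the entries of the differentials between the F_i lie
   in (x_0, ..., x_(n-1)).  By Hilbert's syzygy theorem every homogeneous ideal
   has such a resolution of finite length, and the resulting graded Betti
   numbers do not depend on the choice of F. *)
Definition minimal_graded_free_resolution
    (I : S -> Prop) (F : free_complex) : Prop :=
  [/\ exists len, forall i, (len < i)%N -> rk F i = 0%N,
      degree_preserving (@deg F 0) (fun=> 0) (aug F) /\
      (forall i, degree_preserving (@deg F i.+1) (@deg F i) (diff F i)),
      forall p, I p <-> exists v : 'rV[S]_(rk F 0), (v *m aug F) 0 0 = p,
      (forall v : 'rV[S]_(rk F 0),
         v *m aug F = 0 <-> exists w, w *m diff F 0 = v) /\
      (forall i (v : 'rV[S]_(rk F i.+1)),
         v *m diff F i = 0 <-> exists w, w *m diff F i.+1 = v)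
    & forall i j k, (diff F i j k)@_0%MM = 0].

Definition graded_betti_numbers
    (I : S -> Prop) (beta : nat -> int -> nat) : Prop :=
  exists2 F, minimal_graded_free_resolution I F &
    forall i j, beta i j = #|[set k : 'I_(rk F i) | deg k == j]|.

End Ideals.

Definition is_regularity (beta : nat -> int -> nat) (r : int) : Prop :=
  (exists i j, beta i j <> 0%N /\ j - i%:Z = r) /\
  (forall i j, beta i j <> 0%N -> j - i%:Z <= r).

(* Main.v *)
Require Import Defs.
From mathcomp Require Import all_boot all_order all_algebra.
From mathcomp Require Import mpoly zify.
Set Implicit Arguments.
Unset Strict Implicit.
Unset Printing Implicit Defensive.
Import Order.TTheory GRing.Theory Num.Theory.
Local Open Scope ring_scope.

(* Let a_k b_k (k < m) be the edges of a maximum induced matching, and set all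
   unmatched variables to 0.  The surviving monomials of I(G)^{s} contain at
   least s of these edges.  Let J_i be the ideal of the monomials divisible by
   the first i edges and by s of the remaining ones; J_(i+1) is the intersection of two ideals
   whose sum is J_i (as in a Betti splitting).  Hence a cocycle F_i -> J_i on a
   graded free resolution F of I(G)^{s} produces a cocycle F_(i+1) -> J_(i+1):
   split the images of the basis vectors and compose one half with the
   differential.  Starting from the augmentation this ends with a map from
   F_(m-s) to the principal ideal J_(m-s), generated in degree 2m.  It does not
   vanish: evaluate it on a lift to F of the Koszul complex of
   a_0, ..., a_(m-s) and follow one coefficient back through the splittings.
   So F_(m-s) has a generator of degree at least 2m, and
   reg >= 2m - (m - s) = m + s. *)

(** * Monomial supports, splittings and substitutions *)

Definition supported (K : fieldType) n (P : 'X_{1..n} -> Prop)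
    (p : {mpoly K[n]}) : Prop :=
  forall w, w \in msupp p -> P w.

(** For such a [P], the polynomials [p] with [supported P p] form a monomial ideal, so ideal
    membership becomes a condition on exponents. *)
Definition upward_closed n (P : 'X_{1..n} -> Prop) : Prop :=
  forall w w' : 'X_{1..n}, P w -> P (w' + w)%MM.

Lemma supported0 (K : fieldType) n (P : 'X_{1..n} -> Prop) :
  supported P (0 : {mpoly K[n]}).
Proof. by move=> w; rewrite msupp0. Qed.

Lemma supportedD (K : fieldType) n (P : 'X_{1..n} -> Prop)
    (p q : {mpoly K[n]}) :
  supported P p -> supported P q -> supported P (p + q).
Proof.
by move=> Pp Pq w /msuppD_le; rewrite mem_cat => /orP[/Pp|/Pq].
Qed.

Lemma supported_sum (K : fieldType) n (P : 'X_{1..n} -> Prop) (I : Type)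
    (r : seq I) (Q : pred I) (F : I -> {mpoly K[n]}) :
  (forall i, Q i -> supported P (F i)) -> supported P (\sum_(i <- r | Q i) F i).
Proof. by move=> PF; apply: big_ind PF; [exact: supported0|exact: supportedD]. Qed.

Lemma supportedM (K : fieldType) n (P : 'X_{1..n} -> Prop)
    (p q : {mpoly K[n]}) :
  upward_closed P -> supported P q -> supported P (p * q).
Proof.
move=> upP Pq w /msuppM_le /allpairsP[[w1 w2] /= [_ /Pq Pw2 ->]].
exact: upP.
Qed.

Lemma supported_mulmx (K : fieldType) n (P : 'X_{1..n} -> Prop) k l r
    (A : 'M[{mpoly K[n]}]_(k, l)) (B : 'M[{mpoly K[n]}]_(l, r)) :
  upward_closed P -> (forall i j, supported P (B i j)) ->
  forall i j, supported P ((A *m B) i j).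
Proof.
by move=> upP PB i j; rewrite mxE; apply: supported_sum => h _; apply: supportedM.
Qed.

(** The K-linear projection onto the span of the monomials in [P]. It is not linear over the
    polynomial ring, so filtering a cocycle need not give a cocycle; that defect is what the
    splittings below exploit. *)
Definition mfilter (K : fieldType) n (P : pred 'X_{1..n}) (p : {mpoly K[n]}) :
    {mpoly K[n]} :=
  \sum_(w <- msupp p | P w) p@_w *: 'X_[w].

Lemma mcoeff_mfilter (K : fieldType) n (P : pred 'X_{1..n}) (p : {mpoly K[n]}) w :
  (mfilter P p)@_w = if P w then p@_w else 0.
Proof.
rewrite /mfilter raddf_sum /=.
have [w_p|/memN_msupp_eq0 p_w] := boolP (w \in msupp p); last first.
  rewrite p_w if_same big1 // => w' _; rewrite mcoeffZ mcoeffX.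
  by case: eqP => [->|_]; rewrite ?p_w ?mul0r ?mulr0.
rewrite big_mkcond (bigD1_seq w) //= mcoeffZ mcoeffX eqxx mulr1 big1 ?addr0.
  by case: ifP.
by move=> w' /negbTE ww'; case: ifP => // _; rewrite mcoeffZ mcoeffX ww' mulr0.
Qed.

Lemma supported_mfilter (K : fieldType) n (P : pred 'X_{1..n})
    (p : {mpoly K[n]}) w :
  w \in msupp (mfilter P p) -> P w /\ w \in msupp p.
Proof. by rewrite !mcoeff_msupp mcoeff_mfilter; case: ifP; rewrite ?eqxx. Qed.

Lemma supported_mfilterC (K : fieldType) n (P : pred 'X_{1..n})
    (p : {mpoly K[n]}) w :
  w \in msupp (p - mfilter P p) -> ~~ P w /\ w \in msupp p.
Proof.
rewrite !mcoeff_msupp mcoeffB mcoeff_mfilter.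
by case: ifP; rewrite ?subrr ?eqxx ?subr0.
Qed.

(** Composition with this tuple sets the variables outside [V] to 0. Being a ring morphism, it
    commutes with matrix products. *)
Definition restrict_vars (K : fieldType) n (V : {set 'I_n}) :
    n.-tuple {mpoly K[n]} :=
  [tuple (if i \in V then 'X_i else 0) | i < n].

Definition indicator n (V : {set 'I_n}) : 'X_{1..n} :=
  [multinom (i \in V : nat) | i < n].

Lemma restrict_varsX (K : fieldType) n (V : {set 'I_n}) (w : 'X_{1..n}) :
  'X_[K, w] \mPo restrict_vars K V =
  if [forall i, (0 < w i)%N ==> (i \in V)] then 'X_[w] else 0.
Proof.
rewrite comp_mpolyX; case: ifPn => [/forallP wV|].
  rewrite [RHS]mpolyXE_id; apply: eq_bigr => i _; rewrite tnth_mktuple.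
  have := wV i; case: (posnP (w i)) => [-> _|_ /= ->] //.
rewrite negb_forall => /existsP[i]; rewrite negb_imply => /andP[wi /negbTE iV].
by rewrite (bigD1 i) //= tnth_mktuple iV expr0n (gtn_eqF wi) mul0r.
Qed.

Lemma mcoeff_restrict_vars (K : fieldType) n (V : {set 'I_n})
    (p : {mpoly K[n]}) w :
  (p \mPo restrict_vars K V)@_w =
  if [forall i, (0 < w i)%N ==> (i \in V)] then p@_w else 0.
Proof.
rewrite -[p \mPo _]/(mmap _ _ _).
transitivity (mfilter (fun w => [forall i, (0 < w i)%N ==> (i \in V)]) p)@_w;
  last by rewrite mcoeff_mfilter.
congr (_@_w); rewrite /mfilter -/(comp_mpoly _ _) {1}[p]mpolyE raddf_sum /=.
rewrite [RHS]big_mkcond; apply: eq_bigr => v _.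
rewrite comp_mpolyZ restrict_varsX; case: ifP => _ //; exact: scaler0.
Qed.

(** * Matching edges dividing a monomial *)

Definition full n (a b : nat -> 'I_n) (w : 'X_{1..n}) (k : nat) : bool :=
  (0 < w (a k))%N && (0 < w (b k))%N.

Lemma fullD n (a b : nat -> 'I_n) (w w' : 'X_{1..n}) k :
  full a b w k -> full a b (w' + w)%MM k.
Proof. by rewrite /full !mnmDE => /andP[wa wb]; apply/andP; split; lia. Qed.

(** The lower index [i] leaves out the edges that earlier splittings have already forced to divide
    the monomial. *)
Definition nfull n (a b : nat -> 'I_n) (i m : nat) (w : 'X_{1..n}) : nat :=
  (\sum_(i <= k < m) full a b w k)%N.

Lemma nfullD n (a b : nat -> 'I_n) i m (w w' : 'X_{1..n}) :
  (nfull a b i m w <= nfull a b i m (w' + w)%MM)%N.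
Proof.
apply: leq_sum => k _; case: (boolP (full _ _ w k)) => // /fullD -> //.
Qed.

Lemma nfull_le n (a b : nat -> 'I_n) i m (w : 'X_{1..n}) :
  (nfull a b i m w <= m - i)%N.
Proof.
rewrite -[(m - i)%N]muln1 -sum_nat_const_nat.
by apply: leq_sum => k _; case: full.
Qed.

Lemma nfull_eq n (a b : nat -> 'I_n) i m (w : 'X_{1..n}) :
  (m - i <= nfull a b i m w)%N -> forall k, (i <= k < m)%N -> full a b w k.
Proof.
move=> le_w k /andP[ik km]; apply: contraTT le_w => Nk; rewrite -ltnNge.
rewrite /nfull (big_cat_nat (n := k)) //=; last exact: ltnW.
rewrite (big_ltn km) (negbTE Nk).
have := nfull_le a b i k w; have := nfull_le a b k.+1 m w.
rewrite /nfull; lia.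
Qed.

(** * Koszul complexes *)

Definition koszul_sign (R : comNzRingType) t (A : {set 'I_t}) (a : 'I_t) : R :=
  (-1) ^+ #|[set c in A | (c < a)%N]|.

(** The value on the basis element e_A of the Koszul differential followed by the linear map e_B ->
    [Phi B]. A lift of the Koszul complex to a resolution is thus a sequence of families [Phi], each
    mapped by the differential to [koszul] of the previous one. *)
Definition koszul (R : comNzRingType) (W : lmodType R) t (x : 'I_t -> R)
    (Phi : {set 'I_t} -> W) (A : {set 'I_t}) : W :=
  \sum_(a in A) (koszul_sign R A a * x a) *: Phi (A :\ a).

Lemma koszul_sign_lt (R : comNzRingType) t (A : {set 'I_t}) (a b : 'I_t) :
  (b < a)%N -> koszul_sign R (A :\ a) b = koszul_sign R A b.
Proof.
move=> ba; rewrite /koszul_sign; congr (_ ^+ #|pred_of_set _|).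
apply/setP => c; rewrite !inE; case: (ltnP c b) => [cb|_]; rewrite ?andbF //.
by rewrite !andbT -val_eqE /= neq_ltn (ltn_trans cb ba).
Qed.

Lemma koszul_sign_gt (R : comNzRingType) t (A : {set 'I_t}) (a b : 'I_t) :
  b \in A -> (b < a)%N -> koszul_sign R (A :\ b) a = - koszul_sign R A a.
Proof.
move=> bA ba; rewrite /koszul_sign (cardsD1 b [set c in A | _]) !inE bA ba /=.
rewrite exprS mulN1r opprK; congr (_ ^+ #|pred_of_set _|).
by apply/setP => c; rewrite !inE andbA.
Qed.

(** Each pair of elements of [A] is deleted in both orders. Deleting the smaller one first flips the
    sign of the larger, deleting the larger first changes nothing, so the two terms cancel. *)
Lemma koszul_koszul (R : comNzRingType) (W : lmodType R) t (x : 'I_t -> R)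
    (Phi : {set 'I_t} -> W) (A : {set 'I_t}) :
  koszul x (koszul x Phi) A = 0.
Proof.
pose G a b := (koszul_sign R A a * x a * (koszul_sign R (A :\ a) b * x b))
                *: Phi (A :\ a :\ b).
have -> : koszul x (koszul x Phi) A =
    \sum_(a in A) (\sum_(b in A | (b < a)%N) G a b
                   + \sum_(b in A | (a < b)%N) G a b).
  apply: eq_bigr => a aA; rewrite /koszul scaler_sumr.
  rewrite (bigID (fun b : 'I_t => (b < a)%N)) /=; congr (_ + _).
    apply: eq_big => b; last by rewrite scalerA.
    by rewrite !inE -val_eqE /=; case: (ltngtP b a); rewrite ?andbT ?andbF.
  apply: eq_big => b; last by rewrite scalerA.
  by rewrite !inE -val_eqE /=; case: (ltngtP b a); rewrite ?andbT ?andbF.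
rewrite big_split /=.
rewrite [X in _ + X](exchange_big_dep (mem A)) /=; last by move=> a b _ /andP[].
rewrite -big_split big1 //= => a aA.
rewrite [X in _ + X](eq_bigl (fun b => (b \in A) && (b < a)%N)); last first.
  by move=> b; rewrite aA.
rewrite -big_split big1 //= => b /andP[bA ba].
rewrite /G (koszul_sign_lt _ _ ba) (koszul_sign_gt _ bA ba).
have -> : A :\ a :\ b = A :\ b :\ a by apply/setP => c; rewrite !inE andbCA.
rewrite -scalerDl -[RHS](scale0r (Phi (A :\ b :\ a))); congr (_ *: _).
by rewrite mulNr mulrN [X in _ - X]mulrC subrr.
Qed.

Lemma koszul_mulmx (R : comNzRingType) t k l (x : 'I_t -> R)
    (Phi : {set 'I_t} -> 'rV[R]_k) (B : 'M[R]_(k, l)) (A : {set 'I_t}) :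
  koszul x Phi A *m B = koszul x (fun C => Phi C *m B) A.
Proof. by rewrite mulmx_suml; apply: eq_bigr => a _; rewrite scalemxAl. Qed.

Lemma koszul_map (R R' : comNzRingType) (f : {rmorphism R -> R'}) t k
    (x : 'I_t -> R) (Phi : {set 'I_t} -> 'rV[R]_k) (A : {set 'I_t}) :
  map_mx f (koszul x Phi A) = koszul (f \o x) (fun C => map_mx f (Phi C)) A.
Proof.
rewrite /koszul raddf_sum /=; apply: eq_bigr => a _.
by rewrite map_mxZ rmorphM rmorph_sign.
Qed.

Lemma eq_koszul (R : comNzRingType) (W : lmodType R) t (x : 'I_t -> R)
    (Phi Psi : {set 'I_t} -> W) (A : {set 'I_t}) :
  (forall a, a \in A -> Phi (A :\ a) = Psi (A :\ a)) ->
  koszul x Phi A = koszul x Psi A.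
Proof. by move=> eqPhi; apply: eq_bigr => a /eqPhi ->. Qed.

(** * Cocycles obtained by repeated splitting *)

(* The cocycle F_i -> J_i; the filter keeps the half of the splitting made of
   the monomials that contain s edges after the edge i. *)
Fixpoint obstruction (K : fieldType) n (F : free_complex K n)
    (V : {set 'I_n}) (a b : nat -> 'I_n) (s m i : nat) :
    'cV[{mpoly K[n]}]_(rk F i) :=
  match i with
  | 0 => map_mx (comp_mpoly (restrict_vars K V)) (aug F)
  | i.+1 => map_mx (comp_mpoly (restrict_vars K V)) (diff F i)
            *m map_mx (mfilter (fun w => (s <= nfull a b i.+1 m w)%N))
                 (obstruction F V a b s m i)
  end.

Lemma mulmx_row_eq0 (R : pzRingType) k l (A : 'M[R]_(k, l)) :
  (forall v : 'rV_k, v *m A = 0) -> A = 0.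
Proof. by move=> A0; apply/row_matrixP => i; rewrite rowE A0 row0. Qed.

Lemma msupp_restrict_vars (K : fieldType) n (V : {set 'I_n})
    (p : {mpoly K[n]}) w :
  w \in msupp (p \mPo restrict_vars K V) ->
  (forall i, (0 < w i)%N -> i \in V) /\ w \in msupp p.
Proof.
rewrite !mcoeff_msupp mcoeff_restrict_vars; case: ifP; last by rewrite eqxx.
by move=> /forallP wV; split=> // i; have /implyP := wV i.
Qed.

(** Substitution is a ring morphism and so preserves the vanishing of consecutive composites, and
    every map after the first starts with a differential. This is the cocycle condition. *)
Lemma diff_obstruction (K : fieldType) n (F : free_complex K n)
    (V : {set 'I_n}) (a b : nat -> 'I_n) (s m i : nat) :
  diff F 0 *m aug F = 0 -> (forall j, diff F j.+1 *m diff F j = 0) ->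
  map_mx (comp_mpoly (restrict_vars K V)) (diff F i)
    *m obstruction F V a b s m i = 0.
Proof.
move=> d0 dS; case: i => [|i] /=; first by rewrite -map_mxM d0 map_mx0.
by rewrite mulmxA -map_mxM dS map_mx0 mul0mx.
Qed.

(** By the cocycle condition, [d] of the kept half is minus [d] of the discarded half. The kept half
    supplies the first [i] edges and [s] edges after edge [i]. Monomials of the discarded half have
    [s] edges from [i] on but fewer than [s] after it, so they contain edge [i]. The common image
    has both properties. *)
Lemma obstruction_full (K : fieldType) n (F : free_complex K n)
    (V : {set 'I_n}) (a b : nat -> 'I_n) (s m i : nat) :
  diff F 0 *m aug F = 0 -> (forall j, diff F j.+1 *m diff F j = 0) ->
  (forall h w, w \in msupp (aug F h 0) -> (forall v, (0 < w v)%N -> v \in V) ->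
     (s <= nfull a b 0 m w)%N) ->
  forall h, supported (fun w => (forall l, (l < i)%N -> full a b w l) /\
                                (s <= nfull a b i m w)%N)
              (obstruction F V a b s m i h 0).
Proof.
move=> d0 dS augP; elim: i => [|i IHi] h w.
  by rewrite mxE => /msupp_restrict_vars[wV /augP]; split=> //; auto.
move=> w_th; pose P := fun w => (s <= nfull a b i.+1 m w)%N.
pose th := obstruction F V a b s m i.
pose d := map_mx (comp_mpoly (restrict_vars K V)) (diff F i).
have [full_w s_w] : (forall l, (l < i)%N -> full a b w l) /\ P w.
  pose E := fun w => (forall l, (l < i)%N -> full a b w l) /\ P w.
  apply: (@supported_mulmx K n E _ _ _ d (map_mx (mfilter P) th)) w_th.
    move=> w1 w2 [full1 P1]; split; first by move=> l /full1/fullD.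
    exact: leq_trans P1 (nfullD _ _ _ _ _ _).
  move=> j k w1; rewrite mxE (ord1 k) => /supported_mfilter[Pw1 /IHi[full1 _]].
  by split.
split=> // l; rewrite ltnS leq_eqVlt => /predU1P[->|/full_w//].
have : w \in msupp ((d *m (th - map_mx (mfilter P) th)) h 0).
  rewrite mulmxBr diff_obstruction // sub0r mxE.
  by rewrite (perm_mem (msuppN _)).
apply: (@supported_mulmx K n (fun w => full a b w i)).
  by move=> w1 w2; apply: fullD.
move=> j k w1; rewrite (ord1 k) !mxE => /supported_mfilterC[NP /IHi[_]].
move: NP; rewrite /P -ltnNge /nfull; case: (ltnP i m) => [im|mi].
  by rewrite (big_ltn im); case: full => //=; lia.
by rewrite !big_geq //; lia.
Qed.

(** Substitution and filtering only discard monomials, so homogeneity survives. A monomial in a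
    nonzero entry therefore reveals the degree of a basis vector. *)
Lemma obstruction_deg (K : fieldType) n (F : free_complex K n)
    (V : {set 'I_n}) (a b : nat -> 'I_n) (s m i : nat) :
  degree_preserving (@deg _ _ F 0) (fun=> 0) (aug F) ->
  (forall i, degree_preserving (@deg _ _ F i.+1) (@deg _ _ F i) (diff F i)) ->
  forall h, supported (fun w => (mdeg w)%:Z = deg h)
              (obstruction F V a b s m i h 0).
Proof.
move=> aug_deg diff_deg; elim: i => [|i IHi] h w.
  by rewrite mxE => /msupp_restrict_vars[_ /aug_deg]; rewrite addr0.
rewrite mxE => /msupp_sum_le/flatten_mapP[j _] /msuppM_le.
move=> /allpairsP[[w1 w2] /= [w1_d w2_th ->]].
move: w1_d w2_th; rewrite !mxE => /msupp_restrict_vars[_ /diff_deg <-].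
by move=> /supported_mfilter[_ /IHi <-]; rewrite mdegD PoszD.
Qed.

(** * Combinatorics of the tracked monomials and Koszul faces *)

Lemma indicatorU1 n (v : 'I_n) (Z : {set 'I_n}) :
  v \notin Z -> indicator (v |: Z) = (U_(v) + indicator Z)%MM.
Proof.
move=> /negbTE vZ; apply/mnmP => u; rewrite mnmDE mnm1E !mnmE !inE eq_sym.
by case: eqVneq => [<-|]; rewrite ?vZ.
Qed.

(* For j = m - s, this is the support of the monomial whose coefficient is
   followed at stage i. *)
Definition unpeeled n (V : {set 'I_n}) (a : nat -> 'I_n) (i j : nat) :
    {set 'I_n} :=
  [set v in V | ~~ [exists k : 'I_j, (i <= k)%N && (v == a k)]].

Lemma mem_unpeeled n (V : {set 'I_n}) (a : nat -> 'I_n) i j m l :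
  {in gtn m &, injective a} -> (j <= m)%N -> (l < m)%N -> a l \in V ->
  (a l \in unpeeled V a i j) = ~~ (i <= l < j)%N.
Proof.
move=> a_inj jm lm aV; rewrite inE aV /=; congr (~~ _); apply/existsP/idP.
  move=> [k /andP[ik /eqP /a_inj]]; rewrite !inE => -> //.
    by rewrite ik /=.
  by apply: leq_trans jm.
by move=> /andP[il lj]; exists (Ordinal lj); rewrite il eqxx.
Qed.

(** From stage [i] to the next, the tracked monomial gains exactly the variable [a i] by which the
    Koszul differential multiplies. *)
Lemma unpeeledS n (V : {set 'I_n}) (a : nat -> 'I_n) i j m :
  {in gtn m &, injective a} -> (i < j <= m)%N -> a i \in V ->
  unpeeled V a i.+1 j = a i |: unpeeled V a i j.
Proof.
move=> a_inj /andP[ij jm] aV; apply/setP => v; rewrite !inE.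
have [->|va] := eqVneq v (a i).
  rewrite aV /=; apply/existsP => -[k /andP[ik /eqP /a_inj]].
  by rewrite !inE; have := ltn_ord k; lia.
congr (_ && ~~ _); apply: eq_existsb => k; rewrite ltn_neqAle.
by case: eqVneq => [<-|//]; rewrite (negbTE va) !andbF.
Qed.

(** Identifies the monomial tracked at stage 0 with the image of the Koszul generator of index [j],
    namely [a j] times the common cofactor. *)
Lemma unpeeledSr n (V : {set 'I_n}) (a : nat -> 'I_n) j m :
  {in gtn m &, injective a} -> (j < m)%N -> a j \in V ->
  unpeeled V a 0 j = a j |: unpeeled V a 0 j.+1.
Proof.
move=> a_inj jm aV; apply/setP => v; rewrite !inE.
have [->|va] := eqVneq v (a j).
  rewrite aV /=; apply/existsP => -[k /eqP /a_inj].
  by rewrite !inE; have := ltn_ord k; lia.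
congr (_ && ~~ _); apply/existsP/existsP => -[k /= /eqP vk].
  have kj : (k < j.+1)%N by apply: leqW.
  by exists (Ordinal kj); rewrite vk /=.
have kj : (k < j)%N.
  rewrite ltn_neqAle -ltnS ltn_ord andbT; apply: contraNneq va => <-.
  by rewrite vk.
by exists (Ordinal kj); rewrite vk /=.
Qed.

(* The Koszul basis element on which the stage i cocycle is evaluated. *)
Definition active t i : {set 'I_t.+1} :=
  [set k : 'I_t.+1 | (k < i)%N || (k == t :> nat)].

Lemma activeS t i (it : (i < t.+1)%N) :
  (i < t)%N -> active t i.+1 :\ Ordinal it = active t i.
Proof.
move=> lt_it; apply/setP => k; rewrite !inE -val_eqE /= ltnS.
by case: (ltngtP k i) => //= ->; rewrite ltn_eqF.
Qed.

Lemma card_active t i : (i <= t)%N -> #|active t i| = i.+1.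
Proof.
elim: i => [|i IHi] it.
  rewrite (_ : active t 0 = [set ord_max]) ?cards1 //.
  by apply/setP => k; rewrite !inE -val_eqE.
have it1 : (i < t.+1)%N by apply: leqW.
rewrite (cardsD1 (Ordinal it1) (active t i.+1)) activeS //.
rewrite IHi; last exact: ltnW.
by rewrite inE /= ltnSn.
Qed.

(** * Following a coefficient along the Koszul lift *)

Lemma mcoeff_mulXU (K : fieldType) n (v : 'I_n) (q : {mpoly K[n]}) w :
  ('X_v * q)@_(U_(v) + w)%MM = q@_w.
Proof. by rewrite mulrC mcoeffMX. Qed.

Lemma mcoeff_mulXU_eq0 (K : fieldType) n (v : 'I_n) (q : {mpoly K[n]}) w :
  (forall w', w' \in msupp q -> w = (U_(v) + w')%MM -> False) ->
  ('X_v * q)@_w = 0.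
Proof.
move=> Nw; apply/eqP; rewrite mcoeff_eq0; apply/negP.
by rewrite mulrC (perm_mem (msuppMX _ _)) => /mapP[w' /Nw].
Qed.

Lemma restrict_varsXU (K : fieldType) n (V : {set 'I_n}) (v : 'I_n) :
  v \in V -> 'X_v \mPo restrict_vars K V = 'X_v.
Proof. by move=> vV; rewrite comp_mpolyXU -tnth_nth tnth_mktuple vV. Qed.

(* Among the Koszul faces of [active _ i.+1], only the one omitting i can
   contribute to this coefficient: omitting any other k leaves a monomial not
   divisible by a k, which lacks an edge it would need to be in the split half. *)
Lemma obstruction_step (K : fieldType) n (F : free_complex K n)
    (V : {set 'I_n}) (a b : nat -> 'I_n) (s m i : nat)
    (Phi : {set 'I_(m - s).+1} -> 'rV[{mpoly K[n]}]_(rk F i))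
    (v : 'rV[{mpoly K[n]}]_(rk F i.+1)) :
  (0 < s <= m)%N -> (i < m - s)%N ->
  {in gtn m &, injective a} -> (forall k, (k < m)%N -> a k \in V) ->
  diff F 0 *m aug F = 0 -> (forall j, diff F j.+1 *m diff F j = 0) ->
  (forall h w, w \in msupp (aug F h 0) -> (forall v, (0 < w v)%N -> v \in V) ->
     (s <= nfull a b 0 m w)%N) ->
  v *m diff F i = koszul (fun k : 'I__ => 'X_(a k)) Phi (active (m - s) i.+1) ->
  exists c : bool,
  ((map_mx (comp_mpoly (restrict_vars K V)) v
     *m obstruction F V a b s m i.+1) 0 0)
    @_(indicator (unpeeled V a i.+1 (m - s))) =
  (-1) ^+ c *
  ((map_mx (comp_mpoly (restrict_vars K V)) (Phi (active (m - s) i))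
     *m obstruction F V a b s m i) 0 0)
    @_(indicator (unpeeled V a i (m - s))).
Proof.
move=> /andP[s_gt0 sm] ims a_inj aV d0 dS augP vP.
have im : (i < m)%N by apply: leq_trans ims (leq_subr _ _).
have th_full := obstruction_full d0 dS augP (i := i).
set th := obstruction F V a b s m i in th_full *.
pose P w := (s <= nfull a b i.+1 m w)%N.
set mu := indicator (unpeeled V a i.+1 (m - s)).
have mu1 u : (mu u <= 1)%N by rewrite mnmE leq_b1.
have mu_a l : (l < m)%N -> mu (a l) = ~~ (i.+1 <= l < m - s)%N.
  by move=> lm; rewrite mnmE (mem_unpeeled _ a_inj) ?leq_subr ?aV.
pose la := map_mx (mfilter P) th.
rewrite /= -/th -[map_mx (mfilter _) _]/la mulmxA -map_mxM vP koszul_map koszul_mulmx.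
have it : (i < (m - s).+1)%N by apply: leqW.
rewrite /koszul summxE raddf_sum /= (bigD1 (Ordinal it)) /=; last first.
  by rewrite !inE /= ltnSn.
rewrite activeS // big1 ?addr0 => [|k /andP[k_act ki]].
  exists (odd #|[set c in active (m - s) i.+1 | (c < Ordinal it)%N]|).
  rewrite mxE /koszul_sign -signr_odd -mulrA.
  rewrite -[(-1) ^+ odd _ in LHS](rmorph_sign (@mpolyC n K)) mul_mpolyC mcoeffZ.
  congr (_ * _); rewrite restrict_varsXU ?aV //.
  have -> : mu = (U_(a i) + indicator (unpeeled V a i (m - s)))%MM.
    rewrite /mu (unpeeledS a_inj) ?ims ?leq_subr ?aV // indicatorU1 //.
    by rewrite (mem_unpeeled _ a_inj) ?leq_subr ?aV // leqnn ims.
  rewrite mcoeff_mulXU; apply/eqP; rewrite eq_sym -subr_eq0 -mcoeffB.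
  have mxB (A B : 'M[{mpoly K[n]}]_1) : A 0 0 - B 0 0 = (A - B) 0 0.
    by rewrite !mxE.
  rewrite mxB -mulmxBr mcoeff_eq0; apply/negP => mu_supp.
  have : full a b (indicator (unpeeled V a i (m - s))) i.
    apply: (supported_mulmx (P := fun w => full a b w i)) mu_supp.
      by move=> w1 w2; apply: fullD.
    move=> j k w1; rewrite (ord1 k) !mxE => /supported_mfilterC[NP].
    move=> /th_full[_]; move: NP; rewrite /P -ltnNge /nfull (big_ltn im).
    by case: full => //=; lia.
  rewrite /full mnmE (mem_unpeeled _ a_inj) ?leq_subr ?aV //.
  by rewrite leqnn ims.
have la_full : supported (fun w => (forall l, (l < i)%N -> full a b w l) /\ P w)
    ((map_mx (comp_mpoly (restrict_vars K V)) (Phi (active (m - s) i.+1 :\ k)) *m la) 0 0).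
  apply: supported_mulmx.
    move=> w1 w2 [full1 P1]; split; first by move=> l /full1/fullD.
    exact: leq_trans P1 (nfullD _ _ _ _ _ _).
  move=> j l w1; rewrite (ord1 l) mxE => /supported_mfilter[Pw1 /th_full[? _]].
  by split.
have km : (k < m)%N by have := ltn_ord k; lia.
rewrite mxE /= restrict_varsXU ?aV //.
rewrite /koszul_sign -mulrA -(rmorph_sign (@mpolyC n K)) mul_mpolyC mcoeffZ.
rewrite mcoeff_mulXU_eq0 ?mulr0 // => w /la_full[full_w Pw] mu_w.
have w_mu l : (w l <= mu l)%N by rewrite mu_w mnmDE leq_addl.
have w_ak : w (a k) = 0%N.
  by have := mu1 (a k); rewrite mu_w mnmDE mnm1E eqxx; lia.
move: k_act; rewrite !inE ltnS => /orP[|/eqP k_last].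
  rewrite leq_eqVlt => /orP[/eqP eq_ki|/full_w/andP[]]; last by rewrite w_ak.
  by case/eqP: ki; apply: val_inj.
(* In the remaining case k = m - s, the monomial misses [a l] for i < l < m - s by the choice of
   [mu], and [a (m - s)] because it was divided out. Only the s - 1 edges after m - s can be
   full. *)
move: Pw; rewrite /P /nfull leqNgt => /negP; apply.
rewrite (big_cat_nat (n := (m - s).+1)) /=; [|lia|lia].
have := nfull_le a b (m - s).+1 m w; rewrite /nfull => le_w.
rewrite big_nat big1 => [|l /andP[il lt_l]]; first by lia.
rewrite /full; case: posnP => //= w_al; exfalso.
have [lt_lms|le_msl] := ltnP l (m - s).
  have := w_mu (a l); rewrite mu_a; last by lia.
  by rewrite il lt_lms; lia.
have eq_lk : l = k by rewrite k_last; lia.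
by move: w_al; rewrite eq_lk w_ak.
Qed.

(** Lifts to F the Koszul complex on [a 0], ..., [a (m - s)] times a fixed monomial; [Phi A] with
    [#|A| = i.+1] is the image of e_A in F_i. The map out of F_i kills [koszul x Phi A] since Koszul
    differentials compose to zero, so exactness lifts one step further. The tracked coefficient
    starts as a sign and each step changes it at most by a sign. *)
Lemma obstruction_chain (K : fieldType) n (F : free_complex K n)
    (V : {set 'I_n}) (a b : nat -> 'I_n) (s m : nat) :
  (0 < s <= m)%N ->
  {in gtn m &, injective a} -> (forall k, (k < m)%N -> a k \in V) ->
  (forall v : 'rV_(rk F 0), v *m aug F = 0 <-> exists w, w *m diff F 0 = v) ->
  (forall i (v : 'rV_(rk F i.+1)),
     v *m diff F i = 0 <-> exists w, w *m diff F i.+1 = v) ->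
  (forall h w, w \in msupp (aug F h 0) -> (forall v, (0 < w v)%N -> v \in V) ->
     (s <= nfull a b 0 m w)%N) ->
  (forall k, (k <= m - s)%N -> exists v : 'rV_(rk F 0), (v *m aug F) 0 0 =
     'X_[U_(a k) + indicator (unpeeled V a 0 (m - s).+1)]) ->
  forall i, (i <= m - s)%N ->
  exists2 Phi : {set 'I_(m - s).+1} -> 'rV[{mpoly K[n]}]_(rk F i),
    forall A : {set 'I_(m - s).+1}, #|A| = i.+2 ->
      exists w, w *m diff F i = koszul (fun k : 'I__ => 'X_(a k)) Phi A
  & exists c : bool,
    ((map_mx (comp_mpoly (restrict_vars K V)) (Phi (active (m - s) i))
       *m obstruction F V a b s m i) 0 0)
      @_(indicator (unpeeled V a i (m - s))) = (-1) ^+ c.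
Proof.
move=> sm a_inj aV exact0 exactS augP liftP.
have d0 : diff F 0 *m aug F = 0.
  by apply: mulmx_row_eq0 => v; rewrite mulmxA; apply/exact0; exists v.
have dS j : diff F j.+1 *m diff F j = 0.
  by apply: mulmx_row_eq0 => v; rewrite mulmxA; apply/exactS; exists v.
pose x (k : 'I_(m - s).+1) : {mpoly K[n]} := 'X_(a k).
elim=> [_|i IHi im].
  pose M : 'rV[{mpoly K[n]}]_1 :=
    const_mx 'X_[indicator (unpeeled V a 0 (m - s).+1)].
  (* Only singletons carry information here; all other faces receive 0, so that [Phi] can be chosen
     on every set. *)
  have /fin_all_exists[Phi PhiP] : forall A : {set 'I_(m - s).+1}, exists v,
      #|A| = 1%N -> v *m aug F = koszul x (fun=> M) A.
    move=> A; case: (eqVneq #|A| 1%N) => [/eqP/cards1P[k ->]|A1].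
      have [v vP] := liftP k (ltn_ord k).
      exists (koszul_sign _ [set k] k *: v) => _; apply/matrixP => i j.
      rewrite /koszul big_set1 (ord1 i) (ord1 j) -scalemxAl mxE vP !mxE.
      by rewrite -mulrA -mpolyXD.
    by exists 0 => /eqP; rewrite (negbTE A1).
  exists Phi => [A A2|].
    apply/exact0; rewrite koszul_mulmx -[RHS](koszul_koszul x (fun=> M) A).
    apply: eq_koszul => k kA; apply: PhiP.
    by move: A2; rewrite (cardsD1 k) kA => -[].
  have active0 : active (m - s) 0 = [set ord_max].
    by apply/setP => k; rewrite !inE -val_eqE.
  have lt_msm : (m - s < m)%N by lia.
  exists (odd #|[set c in [set (ord_max : 'I_(m - s).+1)] | (c < m - s)%N]|).
  rewrite /= active0 -map_mxM PhiP ?cards1 // /koszul big_set1 !mxE.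
  rewrite /koszul_sign -signr_odd -mulrA.
  rewrite rmorphM rmorph_sign -(rmorph_sign (@mpolyC n K)) mul_mpolyC mcoeffZ /=.
  rewrite -mpolyXD -indicatorU1 -?(unpeeledSr a_inj) ?aV //; last first.
    by rewrite (mem_unpeeled _ a_inj) ?aV ?ltnSn.
  rewrite mcoeff_restrict_vars ifT ?mcoeffX ?eqxx ?mulr1 //.
  by apply/forallP => v; rewrite mnmE !inE; case: (v \in V); rewrite ?implybT.
have [Phi PhiP [c cP]] := IHi (ltnW im).
have /fin_all_exists[Psi PsiP] : forall A : {set 'I_(m - s).+1}, exists w,
    #|A| = i.+2 -> w *m diff F i = koszul x Phi A.
  move=> A; have [A2|A2] := eqVneq #|A| i.+2; last first.
    by exists 0 => /eqP; rewrite (negbTE A2).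
  by have [w wP] := PhiP A A2; exists w; rewrite wP.
exists Psi => [A A3|].
  apply/exactS; rewrite koszul_mulmx -[RHS](koszul_koszul x Phi A).
  apply: eq_koszul => k kA; apply: PsiP.
  by move: A3; rewrite (cardsD1 k) kA => -[].
have Psi_act := PsiP _ (card_active im).
have [c' ->] := obstruction_step sm im a_inj aV d0 dS augP Psi_act.
by exists (c' (+) c); rewrite cP signr_addb.
Qed.

(** * A generator of large degree *)

Lemma mdeg_full n (a b : nat -> 'I_n) (m : nat) (w : 'X_{1..n}) :
  {in gtn m &, injective a} -> {in gtn m &, injective b} ->
  (forall k l, (k < m)%N -> (l < m)%N -> a k != b l) ->
  (forall k, (k < m)%N -> full a b w k) -> (m.*2 <= mdeg w)%N.
Proof.
move=> a_inj b_inj ab full_w; pose r := map a (iota 0 m) ++ map b (iota 0 m).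
have in_iota : {subset iota 0 m <= gtn m} by move=> k; rewrite mem_iota !inE.
have r_uniq : uniq r.
  rewrite cat_uniq !map_inj_in_uniq ?iota_uniq ?andbT /=; first last.
  - by move=> k l /in_iota + /in_iota; apply: a_inj.
  - by move=> k l /in_iota + /in_iota; apply: b_inj.
  apply/hasPn => _ /mapP[l /in_iota lm ->]; apply/negP => /mapP[k /in_iota km].
  by move=> eq_ba; have := ab k l km lm; rewrite eq_ba eqxx.
rewrite mdegE (bigID (mem r)) /= -big_uniq //.
apply: leq_trans (leq_addr _ _).
have -> : m.*2 = (\sum_(v <- r) 1)%N.
  by rewrite sum1_size size_cat !size_map size_iota addnn.
rewrite big_seq [X in (_ <= X)%N]big_seq; apply: leq_sum => v.
by rewrite mem_cat => /orP[] /mapP[k /in_iota/full_w/andP[? ?] ->].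
Qed.

(** The cocycle at stage m - s is nonzero, having a value with coefficient 1 up to sign. Its
    monomials contain the first m - s edges and [s] of the last [s], hence all 2m distinct ends. *)
Lemma resolution_top_degree (K : fieldType) n (F : free_complex K n)
    (V : {set 'I_n}) (a b : nat -> 'I_n) (s m : nat) :
  (0 < s <= m)%N ->
  {in gtn m &, injective a} -> {in gtn m &, injective b} ->
  (forall k l, (k < m)%N -> (l < m)%N -> a k != b l) ->
  (forall k, (k < m)%N -> a k \in V) ->
  degree_preserving (@deg _ _ F 0) (fun=> 0) (aug F) ->
  (forall i, degree_preserving (@deg _ _ F i.+1) (@deg _ _ F i) (diff F i)) ->
  (forall v : 'rV_(rk F 0), v *m aug F = 0 <-> exists w, w *m diff F 0 = v) ->
  (forall i (v : 'rV_(rk F i.+1)),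
     v *m diff F i = 0 <-> exists w, w *m diff F i.+1 = v) ->
  (forall h w, w \in msupp (aug F h 0) -> (forall v, (0 < w v)%N -> v \in V) ->
     (s <= nfull a b 0 m w)%N) ->
  (forall k, (k <= m - s)%N -> exists v : 'rV_(rk F 0), (v *m aug F) 0 0 =
     'X_[U_(a k) + indicator (unpeeled V a 0 (m - s).+1)]) ->
  exists k : 'I_(rk F (m - s)), (m.*2)%:Z <= deg k.
Proof.
move=> sm a_inj b_inj ab aV aug_deg diff_deg exact0 exactS augP liftP.
have d0 : diff F 0 *m aug F = 0.
  by apply: mulmx_row_eq0 => v; rewrite mulmxA; apply/exact0; exists v.
have dS j : diff F j.+1 *m diff F j = 0.
  by apply: mulmx_row_eq0 => v; rewrite mulmxA; apply/exactS; exists v.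
have [Phi _ [c]] :=
  obstruction_chain sm a_inj aV exact0 exactS augP liftP (leqnn (m - s)).
have [-> |[k /eqP th_k]] : obstruction F V a b s m (m - s) = 0 \/
    exists k, obstruction F V a b s m (m - s) k 0 != 0.
  have [/existsP|] := boolP [exists k, obstruction F V a b s m (m - s) k 0 != 0].
    by right.
  rewrite negb_exists => /forallP th0; left; apply/matrixP => k j.
  by rewrite (ord1 j) [RHS]mxE; apply/eqP; have := th0 k; rewrite negbK.
  rewrite mulmx0 mxE mcoeff0 => /esym/eqP; by rewrite signr_eq0.
move=> _; exists k; have /eqP/mlead_supp w_supp := th_k.
rewrite -(obstruction_deg aug_deg diff_deg w_supp).
have [low_w s_w] := obstruction_full d0 dS augP w_supp.
rewrite lez_nat; apply: mdeg_full a_inj b_inj ab _ => l lm.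
have [/low_w//|ms_l] := ltnP l (m - s).
by apply: (nfull_eq (i := m - s) (m := m)); [lia|rewrite ms_l lm].
Qed.

(** * Ideals generated by monomials and their powers *)

Lemma gen_ideal_gen (K : fieldType) n (A : {mpoly K[n]} -> Prop) p :
  A p -> gen_ideal A p.
Proof.
move=> Ap; exists 1%N, (fun=> 1), (fun=> p); split=> //.
by rewrite big_ord1 mul1r.
Qed.

Lemma gen_ideal0 (K : fieldType) n (A : {mpoly K[n]} -> Prop) : gen_ideal A 0.
Proof. by exists 0%N, (fun=> 0), (fun=> 0); split=> [[]|] //; rewrite big_ord0. Qed.

Lemma gen_idealM (K : fieldType) n (A : {mpoly K[n]} -> Prop) q p :
  gen_ideal A p -> gen_ideal A (q * p).
Proof.
move=> [k [a [g [Ag ->]]]]; exists k, (fun i => q * a i), g; split=> //.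
by rewrite mulr_sumr; apply: eq_bigr => i _; rewrite mulrA.
Qed.

Lemma gen_idealD (K : fieldType) n (A : {mpoly K[n]} -> Prop) p q :
  gen_ideal A p -> gen_ideal A q -> gen_ideal A (p + q).
Proof.
move=> [k [a [g [Ag ->]]]] [l [b [h [Ah ->]]]].
exists (k + l)%N, (fun i => match split i with inl j => a j | inr j => b j end).
exists (fun i => match split i with inl j => g j | inr j => h j end); split.
  by move=> i; case: split.
by rewrite big_split_ord; congr (_ + _); apply: eq_bigr => i _;
   rewrite ?(unsplitK (inl i)) ?(unsplitK (inr i)).
Qed.

Lemma gen_ideal_monomials (K : fieldType) n (A : {mpoly K[n]} -> Prop) p :
  supported (fun w => gen_ideal A 'X_[w]) p -> gen_ideal A p.
Proof.
move=> Ap; rewrite [p]mpolyE big_seq.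
apply: (big_ind (gen_ideal A)) => [||w /Ap]; first exact: gen_ideal0.
  exact: gen_idealD.
by rewrite -mul_mpolyC; apply: gen_idealM.
Qed.

Lemma supported_gen_ideal (K : fieldType) n (A : {mpoly K[n]} -> Prop)
    (P : 'X_{1..n} -> Prop) p :
  upward_closed P -> (forall q, A q -> supported P q) ->
  gen_ideal A p -> supported P p.
Proof.
move=> upP AP [k [a [g [Ag ->]]]]; apply: supported_sum => i _.
by apply: supportedM => //; apply: AP.
Qed.

Lemma var_idealP (K : fieldType) n (C : {set 'I_n}) (p : {mpoly K[n]}) :
  var_ideal C p <-> supported (fun w => exists2 i, i \in C & (0 < w i)%N) p.
Proof.
split.
  apply: supported_gen_ideal => [w w' [i iC wi]|_ [i iC ->] w].
    by exists i => //; rewrite mnmDE addn_gt0 wi orbT.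
  by rewrite msuppX inE => /eqP->; exists i; rewrite // mnm1E eqxx.
move=> Cp; apply: gen_ideal_monomials => w /Cp[i iC wi].
have /submK <- : (U_(i) <= w)%MM.
  by apply/mnm_lepP => j; rewrite mnm1E; case: eqP => [<-|].
by rewrite mpolyXD; apply: gen_idealM; apply: gen_ideal_gen; exists i.
Qed.

(** Irreflexivity makes the ends of an edge distinct, so positive exponents at both already give
    divisibility by their product. *)
Lemma edge_idealP (K : fieldType) n (e : rel 'I_n) (p : {mpoly K[n]}) :
  irreflexive e ->
  edge_ideal e p <->
  supported (fun w => exists i j, [/\ e i j, (0 < w i)%N & (0 < w j)%N]) p.
Proof.
move=> e_irr; split.
  apply: supported_gen_ideal => [w w' [i [j [eij wi wj]]]|_ [i [j [eij ->]]] w].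
    by exists i, j; split=> //; rewrite mnmDE ltn_addl.
  rewrite -mpolyXD msuppX inE => /eqP->; exists i, j.
  by split=> //; rewrite mnmDE !mnm1E eqxx ?addn1.
move=> ep; apply: gen_ideal_monomials => w /ep[i [j [eij wi wj]]].
have /submK <- : (U_(i) + U_(j) <= w)%MM.
  apply/mnm_lepP => k; rewrite mnmDE !mnm1E.
  have [ik|] := eqVneq i k; have [jk|] := eqVneq j k => //=.
  - by move: eij; rewrite ik jk e_irr.
  - by rewrite -ik.
  - by rewrite -jk.
rewrite !mpolyXD; apply: gen_idealM; apply: gen_ideal_gen.
by exists i, j.
Qed.

Lemma supported_ideal_pow (K : fieldType) n (C : {set 'I_n}) s
    (p : {mpoly K[n]}) :
  ideal_pow (var_ideal C) s p ->
  supported (fun w => (s <= \sum_(i in C) w i)%N) p.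
Proof.
apply: supported_gen_ideal => [w w' sw|_ [f [Cf ->]]].
  apply: leq_trans sw _; apply: leq_sum => i _; by rewrite mnmDE leq_addl.
elim: s f Cf => [|s IHs] f Cf w; first by [].
rewrite big_ord_recl => /msuppM_le/allpairsP[[w1 w2] /= [w1f w2f ->]].
have [i iC w1i] := (var_idealP C (f ord0)).1 (Cf ord0) _ w1f.
have /= le_s := IHs (fun i => f (lift ord0 i)) (fun i => Cf _) _ w2f.
rewrite (eq_bigr (fun i => w1 i + w2 i)%N) => [|j _]; last by rewrite mnmDE.
rewrite big_split /= (bigD1 i iC) /=; lia.
Qed.

Lemma ideal_pow_monomial (K : fieldType) n (C : {set 'I_n}) s (w : 'X_{1..n}) :
  (s <= \sum_(i in C) w i)%N -> ideal_pow (var_ideal C) s ('X_[w] : {mpoly K[n]}).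
Proof.
elim: s w => [|s IHs] w sw.
  rewrite -[X in ideal_pow _ _ X]mulr1; apply: gen_idealM.
  (* The empty product is 1, and any function on ['I_0] presents it. *)
  apply: gen_ideal_gen; exists (fun=> 0); split; first by case.
  by rewrite big_ord0.
have /existsP[i /andP[iC wi]] : [exists i, (i \in C) && (0 < w i)%N].
  apply: contraTT sw; rewrite negb_exists => /forallP w0; rewrite big1 // => i iC.
  by have := w0 i; rewrite iC /= -leqNgt leqn0 => /eqP.
have Uw : (U_(i) <= w)%MM.
  by apply/mnm_lepP => j; rewrite mnm1E; case: eqP => [<-|].
have [|k [a [g [/= gP gE]]]] := IHs (w - U_(i))%MM.
  move: sw; rewrite -{1}(submK Uw).
  rewrite (eq_bigr (fun j => (w - U_(i))%MM j + U_(i)%MM j)%N); last first.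
    by move=> j _; rewrite mnmDE.
  rewrite big_split /= [X in (_ + X)%N](bigD1 i iC) /= mnm1E eqxx.
  rewrite [X in (_ + (_ + X))%N]big1 => [|j /andP[_ ji]]; first by lia.
  by rewrite mnm1E eq_sym (negbTE ji).
exists k, a, (fun j => 'X_i * g j); split.
  move=> j; have [f [fC ->]] := gP j.
  exists (fun l => if unlift ord0 l is Some l' then f l' else 'X_i); split.
    by move=> l; case: unlift => //; apply: gen_ideal_gen; exists i.
  rewrite big_ord_recl unlift_none; congr (_ * _); apply: eq_bigr => l _.
  by rewrite liftK.
rewrite -(submK Uw) mpolyXD gE mulr_suml; apply: eq_bigr => j _.
by rewrite -mulrA [g j * _]mulrC.
Qed.

(** * Minimal vertex covers and symbolic powers *)

Definition vertex_cover n (e : rel 'I_n) (C : {set 'I_n}) : bool :=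
  [forall i, forall j, e i j ==> (i \in C) || (j \in C)].

Lemma vertex_coverP n (e : rel 'I_n) (C : {set 'I_n}) :
  reflect (forall i j, e i j -> (i \in C) || (j \in C)) (vertex_cover e C).
Proof.
apply: (iffP forallP) => [coverC i j|coverC i].
  by have /forallP/(_ j)/implyP := coverC i.
by apply/forallP => j; apply/implyP; apply: coverC.
Qed.

(** If a monomial contains no edge, the vertices it misses form a cover, and the prime of a minimal
    cover inside them excludes the monomial. *)
Lemma minimal_vertex_covers_decomposition (K : fieldType) n (e : rel 'I_n) :
  irreflexive e ->
  irredundant_primary_decomposition (@edge_ideal K n e)
    [set C | minset (vertex_cover e) C].
Proof.
move=> e_irr; split.
  move=> p; split=> [ep C|Cp].
    rewrite inE => /minsetp/vertex_coverP coverC; apply/var_idealP => w.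
    move/(edge_idealP _ e_irr): ep => ep /ep[i [j [/coverC]]].
    by case/orP => ? ? ?; [exists i|exists j].
  apply/(edge_idealP _ e_irr) => w w_p.
  have [/existsP[i /existsP[j /and3P[eij wi wj]]]|Nw] :=
    boolP [exists i, exists j, [&& e i j, (0 < w i)%N & (0 < w j)%N]].
    by exists i, j.
  have cover_w : vertex_cover e [set i | w i == 0%N].
    apply/vertex_coverP => i j eij; rewrite !inE; apply: contraNT Nw.
    rewrite negb_or => /andP[wi wj]; apply/existsP; exists i.
    by apply/existsP; exists j; rewrite eij !lt0n wi.
  have [C Cmin Cw] := minset_exists cover_w.
  have /Cp/var_idealP/(_ w w_p)[i] : C \in [set C | minset (vertex_cover e) C].
    by rewrite inE.
  by move=> /(subsetP Cw); rewrite inE => /eqP->.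
move=> C; rewrite inE => Cmin inter.
(* Irredundance: the product of the variables outside [C] lies in the prime of every other minimal
   cover, as none is contained in [C], yet it contains no edge because [C] is a cover. *)
have : edge_ideal e ('X_[indicator (~: C)] : {mpoly K[n]}).
  apply/inter => D; rewrite !inE => /andP[DC Dmin]; apply/var_idealP => w.
  rewrite msuppX inE => /eqP->.
  have /subsetPn[i iD iC] : ~~ (D \subset C).
    apply: contraNN DC => DC; apply/eqP; apply: minsetinf Cmin _ DC.
    exact: minsetp Dmin.
  by exists i; rewrite // mnmE inE iC.
move/(edge_idealP _ e_irr) => /(_ (indicator (~: C))).
rewrite msuppX mem_head => /(_ isT)[i [j []]].
move/minsetp/vertex_coverP: Cmin => coverC /coverC.
by rewrite !mnmE !inE => /orP[] ->.
Qed.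

Lemma count_le_sum_multiplicity n (m : nat) (c : nat -> 'I_n) (P : pred nat)
    (C : {set 'I_n}) (w : 'X_{1..n}) :
  {in gtn m &, injective c} ->
  (forall k, (k < m)%N -> P k -> c k \in C /\ (0 < w (c k))%N) ->
  (\sum_(0 <= k < m) P k <= \sum_(i in C) w i)%N.
Proof.
move=> c_inj Pc; pose r := map c (filter P (iota 0 m)).
have in_r k : k \in filter P (iota 0 m) -> P k /\ (k < m)%N.
  by rewrite mem_filter mem_iota => /andP[].
have r_uniq : uniq r.
  rewrite map_inj_in_uniq ?filter_uniq ?iota_uniq // => k l /in_r[_ km] /in_r[_ lm].
  exact: c_inj.
have -> : (\sum_(0 <= k < m) P k = \sum_(v <- r) 1)%N.
  rewrite /r big_map big_filter [RHS]big_mkcond /index_iota subn0.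
  by apply: eq_bigr => k _; case: (P k).
apply: (@leq_trans (\sum_(v in r) w v)%N).
  rewrite -big_uniq // big_seq [X in (_ <= X)%N]big_seq; apply: leq_sum => v.
  by move=> /mapP[k /in_r[Pk km] ->]; have [] := Pc k km Pk.
rewrite [X in (_ <= X)%N](bigID (mem r)) /=; apply: leq_trans (leq_addr _ _).
rewrite leq_eqVlt; apply/orP; left; apply/eqP; apply: eq_bigl => v.
rewrite andbC; case: (boolP (v \in r)) => //= /mapP[k /in_r[Pk km] ->].
by have [-> _] := Pc k km Pk.
Qed.

(** Each prime of the decomposition contains every edge monomial, hence an end of every edge. The
    edges are disjoint, so [s] full edges contribute [s] different variables of that prime. *)
Lemma symbolic_power_full (K : fieldType) n (e : rel 'I_n) (a b : nat -> 'I_n)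
    (s m : nat) (w : 'X_{1..n}) :
  (forall k, (k < m)%N -> e (a k) (b k)) ->
  {in gtn m &, injective a} -> {in gtn m &, injective b} ->
  (forall k l, (k < m)%N -> (l < m)%N -> a k != b l) ->
  (s <= nfull a b 0 m w)%N ->
  symbolic_power (@edge_ideal K n e) s 'X_[w].
Proof.
move=> eab a_inj b_inj ab sw P [interP _] C CP; apply: ideal_pow_monomial.
have abC k : (k < m)%N -> (a k \in C) || (b k \in C).
  move=> km; have : edge_ideal e ('X_(a k) * 'X_(b k) : {mpoly K[n]}).
    by apply: gen_ideal_gen; exists (a k), (b k); split=> //; apply: eab.
  move/interP/(_ C CP)/var_idealP; rewrite -mpolyXD.
  move/(_ (U_(a k) + U_(b k))%MM); rewrite msuppX mem_head => /(_ isT)[i iC].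
  by rewrite mnmDE !mnm1E; do 2![case: eqP => [->|_]; rewrite ?iC ?orbT //].
apply: leq_trans sw _.
apply: (count_le_sum_multiplicity (c := fun k => if a k \in C then a k else b k)).
  move=> k l km lm; case: ifP => _; case: ifP => _ //; try exact: a_inj.
  - by move=> /eqP; rewrite (negbTE (ab k l km lm)).
  - by move=> /esym/eqP; rewrite (negbTE (ab l k lm km)).
  - exact: b_inj.
move=> k km /andP[wa wb]; have := abC k km.
by case: (boolP (a k \in C)) => //=.
Qed.

(* For each matching edge, take an endpoint that the monomial misses only if
   the edge is missed entirely; these endpoints are independent because the
   matching is induced, so some minimal vertex cover avoids them all. *)
Lemma full_of_symbolic_power (K : fieldType) n (e : rel 'I_n)
    (a b : nat -> 'I_n) (s m : nat) (w : 'X_{1..n}) :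
  irreflexive e ->
  (forall k l, (k < m)%N -> (l < m)%N -> k <> l ->
     [/\ ~~ e (a k) (a l), ~~ e (a k) (b l), ~~ e (b k) (a l)
       & ~~ e (b k) (b l)]) ->
  (forall v, (w v <= 1)%N) ->
  (forall v, (0 < w v)%N -> exists2 k, (k < m)%N & v = a k \/ v = b k) ->
  symbolic_power (@edge_ideal K n e) s 'X_[w] ->
  (s <= nfull a b 0 m w)%N.
Proof.
move=> e_irr indep w1 wV sympow.
pose c k := if (0 < w (a k))%N then a k else b k.
pose c' k := if (0 < w (a k))%N then b k else a k.
pose T := [set v | [exists k : 'I_m, v == c k]].
have coverT : vertex_cover e (~: T).
  apply/vertex_coverP => i j eij; rewrite !inE -negb_and; apply/negP.
  move=> /andP[/existsP[k /eqP ik] /existsP[l /eqP jl]]; move: eij.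
  rewrite ik jl; have [kl|kl] := eqVneq (k : nat) l; first by rewrite kl e_irr.
  have [/negbTE h1 /negbTE h2 /negbTE h3 /negbTE h4] :=
    indep k l (ltn_ord k) (ltn_ord l) (elimN eqP kl).
  by rewrite /c; case: ifP; case: ifP; rewrite ?h1 ?h2 ?h3 ?h4.
have [C Cmin CT] := minset_exists coverT.
have : C \in [set D | minset (vertex_cover e) D] by rewrite inE.
move/(sympow _ (minimal_vertex_covers_decomposition K e_irr)).
move/supported_ideal_pow/(_ w); rewrite msuppX mem_head => /(_ isT) /leq_trans.
(* As [C] avoids every [c k], its vertices in the support of [w] are among the [c' k]. Moreover
   [w (c' k)] is at most 1, and positive only if edge [k] is full. *)
apply; apply: (@leq_trans (\sum_(i in C) \sum_(0 <= k < m | i == c' k) w i)%N).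
  apply: leq_sum => i iC; case: (posnP (w i)) => [-> //|wi].
  have [k km ik] := wV i wi.
  rewrite big_mkord (bigD1 (Ordinal km)) /= ?leq_addr //.
  have /subsetP/(_ i iC) := CT; rewrite !inE negb_exists => /forallP.
  move=> /(_ (Ordinal km)) /=; rewrite /c /c'.
  by case: ik => ->; case: ifP => //; rewrite eqxx.
rewrite (exchange_big_dep xpredT) //=; apply: leq_sum => k _.
apply: (@leq_trans (w (c' k))).
  have [ckC|ckC] := boolP (c' k \in C).
    rewrite (big_pred1 (c' k)) // => i /=.
    by case: eqVneq => [->|]; rewrite ?andbF ?ckC.
  rewrite big_pred0 // => i.
  by case: eqVneq => [->|]; rewrite ?andbF ?(negbTE ckC).
rewrite /c' /full; case: (posnP (w (a k))) => [->|_] //=.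
by have := w1 (b k); case: (w (b k)) => [|[]].
Qed.

(** * Vertices of a maximum induced matching *)

Lemma ind_match_witness n (e : rel 'I_n) :
  (0 < ind_match e)%N ->
  exists2 M, induced_matching e M & #|M| = ind_match e.
Proof.
move=> m_gt0.
have M_gt0 : (0 < #|[pred M | induced_matching e M]|)%N.
  rewrite lt0n; apply: contraTneq m_gt0 => /card0_eq M0.
  rewrite -leqNgt /ind_match big_pred0 // => M; exact: M0.
have [M MP eM] := eq_bigmax_cond (fun M : {set {set 'I_n}} => #|M|) M_gt0.
by exists M => //; rewrite -eM.
Qed.

Lemma induced_matching_vertices n (e : rel 'I_n) (M : {set {set 'I_n}}) :
  irreflexive e -> induced_matching e M -> (0 < #|M|)%N ->
  exists a b : nat -> 'I_n,
    [/\ forall k, (k < #|M|)%N -> e (a k) (b k),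
        {in gtn #|M| &, injective a}, {in gtn #|M| &, injective b},
        forall k l, (k < #|M|)%N -> (l < #|M|)%N -> a k != b l
      & forall k l, (k < #|M|)%N -> (l < #|M|)%N -> k <> l ->
          [/\ ~~ e (a k) (a l), ~~ e (a k) (b l), ~~ e (b k) (a l)
            & ~~ e (b k) (b l)]].
Proof.
move=> e_irr /andP[/andP[Me Mtriv] Mind] m_gt0; set m := #|M| in m_gt0 *.
pose f k := nth set0 (enum M) k.
have fM k : (k < m)%N -> f k \in M.
  by move=> km; rewrite -mem_enum mem_nth // -cardE.
have f_inj k l : (k < m)%N -> (l < m)%N -> f k = f l -> k = l.
  move=> km lm /eqP; rewrite nth_uniq ?enum_uniq -?cardE // => /eqP.
  exact.
have /fin_all_exists[p pP] : forall k : 'I_m, exists p : 'I_n * 'I_n,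
    e p.1 p.2 /\ f k = [set p.1; p.2].
  move=> k; have /(subsetP Me) := fM k (ltn_ord k).
  rewrite inE => /existsP[i /existsP[j /andP[eij /eqP ->]]].
  by exists (i, j).
(* Indices beyond the range fall back to edge 0, which exists because [M] is nonempty. *)
pose q k := p (insubd (Ordinal m_gt0) k).
have qP k : (k < m)%N -> e (q k).1 (q k).2 /\ f k = [set (q k).1; (q k).2].
  move=> km; have := pP (insubd (Ordinal m_gt0) k).
  by rewrite -/(q k) val_insubd km.
have f_disj k l v : (k < m)%N -> (l < m)%N -> v \in f k -> v \in f l -> k = l.
  move=> km lm vk vl; apply: f_inj => //; apply/eqP; apply/negPn/negP => kl.
  have /trivIsetP/(_ _ _ (fM k km) (fM l lm) kl) := Mtriv.
  by move=> /disjoint_setI0/setP/(_ v); rewrite !inE vk vl.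
(* An edge uv joining two members lies in [M], since the matching is induced. It meets both members,
   so disjointness makes it equal to each of them, and the members coincide. *)
have f_indep k l u v : (k < m)%N -> (l < m)%N -> k <> l ->
    u \in f k -> v \in f l -> ~~ e u v.
  move=> km lm kl uk vl; apply/negP => euv.
  have uvE : [set u; v] \in edge_set e.
    by rewrite inE; apply/existsP; exists u; apply/existsP; exists v; rewrite euv /=.
  have uvM : [set u; v] \in M.
    apply: contraTT isT => uvM.
    have /forall_inP/(_ _ (fM k km))/forall_inP/(_ _ (fM l lm)) := Mind.
    move=> /forall_inP/(_ [set u; v]); rewrite inE uvM uvE => /(_ isT)/negP; case.
    by rewrite subUset !sub1set !inE uk vl orbT.
  have uvf h w : (h < m)%N -> w \in f h -> w \in [set u; v] -> f h = [set u; v].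
    move=> hm wh wuv; apply/eqP; apply/negPn/negP => huv.
    have /trivIsetP/(_ _ _ (fM h hm) uvM huv) := Mtriv.
    by move=> /disjoint_setI0/setP/(_ w); rewrite in_setI wh wuv inE.
  have fk : f k = [set u; v] by apply: (uvf k u); rewrite ?set21.
  have fl : f l = [set u; v] by apply: (uvf l v); rewrite ?set22.
  by apply: kl; apply: f_inj; rewrite ?fk.
have q1 k : (k < m)%N -> (q k).1 \in f k.
  by move=> /qP[_ ->]; rewrite !inE eqxx.
have q2 k : (k < m)%N -> (q k).2 \in f k.
  by move=> /qP[_ ->]; rewrite !inE eqxx orbT.
exists (fun k => (q k).1), (fun k => (q k).2); split.
- by move=> k /qP[].
- move=> k l km lm qkl.
  by apply: (f_disj k l (q k).1) => //; [apply: q1|rewrite qkl; apply: q1].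
- move=> k l km lm qkl.
  by apply: (f_disj k l (q k).2) => //; [apply: q2|rewrite qkl; apply: q2].
- move=> k l km lm; apply/eqP => qkl.
  have kl : k = l.
    by apply: (f_disj k l (q k).1) => //; [apply: q1|rewrite qkl; apply: q2].
  by have [] := qP k km; rewrite qkl kl e_irr.
- by move=> k l km lm kl; split; apply: (f_indep k l); auto.
Qed.

(** * Application to the edge ideal and its regularity *)

Lemma resolution_top_degree_ind_match (K : fieldType) n (e : rel 'I_n) s
    (F : free_complex K n) :
  irreflexive e -> (1 <= s <= ind_match e)%N ->
  minimal_graded_free_resolution
    (squarefree_part (symbolic_power (@edge_ideal K n e) s)) F ->
  exists k : 'I_(rk F (ind_match e - s)), ((ind_match e).*2)%:Z <= deg k.
Proof.
move=> e_irr /andP[s_gt0 s_le] [_ [aug_deg diff_deg] J_aug [exact0 exactS] _].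
have [M Mind Mm] := ind_match_witness (leq_trans s_gt0 s_le).
have := induced_matching_vertices e_irr Mind.
rewrite Mm; set m := ind_match e in s_le *; case; first by lia.
move=> a [b [eab a_inj b_inj ab indep]].
pose V := [set v | [exists k : 'I_m, (v == a k) || (v == b k)]].
have aV k : (k < m)%N -> a k \in V.
  by move=> km; rewrite inE; apply/existsP; exists (Ordinal km); rewrite eqxx.
have bV k : (k < m)%N -> b k \in V.
  by move=> km; rewrite inE; apply/existsP; exists (Ordinal km); rewrite eqxx orbT.
apply: (resolution_top_degree (V := V) (a := a) (b := b)) => //.
- by rewrite s_gt0.
- move=> h; have : squarefree_part (symbolic_power (@edge_ideal K n e) s) (aug F h 0).
    by apply/J_aug; exists (delta_mx 0 h); rewrite -rowE mxE.
  (* The condition passes to multiples, because divisors of a monomial in the variables of [V] are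
     again such monomials. Only the squarefree generators remain to be checked. *)
  apply: (supported_gen_ideal
    (P := fun w => (forall v, (0 < w v)%N -> v \in V) -> (s <= nfull a b 0 m w)%N)).
    move=> w w' sw w'V; apply: leq_trans (sw _) (nfullD _ _ _ _ _ _).
    by move=> v wv; apply: w'V; rewrite mnmDE ltn_addl.
  move=> _ [u [u1 -> u_sym]] w; rewrite msuppX inE => /eqP-> uV.
  apply: full_of_symbolic_power e_irr indep u1 _ u_sym => v /uV.
  rewrite inE => /existsP[k /orP vk]; exists k => //.
  by case: vk => /eqP; [left|right].
(* The Koszul generators lie in the ideal: [Z] contains the s - 1 edges after m - s in full and
   every [b l], so adding [a k] completes an s-th edge. *)
move=> k k_le; set Z := unpeeled V a 0 (m - s).+1.
have s_m : ((m - s).+1 <= m)%N by lia.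
have akZ : a k \notin Z.
  by rewrite (mem_unpeeled _ a_inj) ?aV ?ltnS ?negbK //; lia.
have aZ l : ((m - s).+1 <= l < m)%N -> a l \in Z.
  move=> /andP[sl lm]; rewrite (mem_unpeeled _ a_inj) ?aV //=; lia.
have bZ l : (l < m)%N -> b l \in Z.
  move=> lm; rewrite inE bV //=; apply/existsP => -[h /eqP bh].
  have hm : (h < m)%N by have := ltn_ord h; lia.
  by have := ab h l hm lm; rewrite bh eqxx.
suff /J_aug[v vP] : squarefree_part (symbolic_power (@edge_ideal K n e) s)
    'X_[indicator (a k |: Z)] by exists v; rewrite vP indicatorU1.
apply: gen_ideal_gen; exists (indicator (a k |: Z)); split=> //.
  by move=> v; rewrite mnmE leq_b1.
apply: symbolic_power_full eab a_inj b_inj ab _.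
have fullZ l : (l < m)%N -> full a b (indicator (a k |: Z)) l =
    (a l == a k) || (a l \in Z).
  by move=> lm; rewrite /full !mnmE !in_setU1 bZ // orbT andbT lt0b.
rewrite /nfull (big_cat_nat (n := (m - s).+1)) //=.
have -> : (\sum_((m - s).+1 <= l < m) full a b (indicator (a k |: Z)) l = s.-1)%N.
  rewrite (eq_big_nat _ _ (F2 := fun=> 1%N)) ?sum_nat_const_nat.
    by rewrite muln1; lia.
  by move=> l sl; rewrite fullZ ?aZ ?orbT //; case/andP: sl.
have k_lt : (k < (m - s).+1)%N by [].
rewrite big_mkord (bigD1 (Ordinal k_lt)) //= fullZ ?eqxx /=; lia.
Qed.

(** Finite length leaves finitely many basis vectors, so degree minus homological index attains a
    maximum; the given [k] shows that there is a basis vector at all. *)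
Lemma exists_regularity (K : fieldType) n (F : free_complex K n) len
    (beta : nat -> int -> nat) :
  (forall i, (len < i)%N -> rk F i = 0%N) ->
  (forall i j, beta i j = #|[set k : 'I_(rk F i) | deg k == j]|) ->
  forall i (k : 'I_(rk F i)),
    exists2 r, is_regularity beta r & deg k - i%:Z <= r.
Proof.
move=> lenP betaE i k.
have lt_len h (l : 'I_(rk F h)) : (h < len.+1)%N.
  by rewrite ltnS leqNgt; apply/negP => /lenP rk0; case: l; rewrite rk0.
pose I := {h : 'I_len.+1 & 'I_(rk F h)}.
pose f (x : I) : int := deg (tagged x) - (tag x)%:Z.
pose mk h (l : 'I_(rk F h)) : I :=
  @Tagged 'I_len.+1 (Ordinal (lt_len h l)) (fun h => 'I_(rk F h)) l.
case: (@Order.TotalTheory.arg_maxP _ int I (mk i k) xpredT f) => // x _ xmax.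
exists (f x); last exact: (xmax (mk i k)).
split.
  exists (tag x), (deg (tagged x)); split=> //.
  by rewrite betaE; apply/eqP; rewrite -lt0n; apply/card_gt0P; exists (tagged x); rewrite inE.
move=> h j /eqP; rewrite betaE -lt0n => /card_gt0P[l]; rewrite inE => /eqP <-.
exact: (xmax (mk h l)).
Qed.

Theorem theorem3p3 (K : fieldType) (n : nat) (e : rel 'I_n)
    (e_sym : ssrbool.symmetric e) (e_irr : irreflexive e)
    (s : nat) (s_ge1 : (1 <= s)%N) (s_le : (s <= ind_match e)%N)
    (beta : nat -> int -> nat)
    (betaP : graded_betti_numbers
               (squarefree_part (symbolic_power (@edge_ideal K n e) s)) beta) :
  exists2 reg : int, is_regularity beta reg & (s + ind_match e)%:Z <= reg.
Proof.
have [F resF betaE] := betaP.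
have s_bounds : (1 <= s <= ind_match e)%N by rewrite s_ge1.
have [k deg_k] := resolution_top_degree_ind_match e_irr s_bounds resF.
have [[len lenP] _ _ _ _] := resF.
have [r r_reg le_r] := exists_regularity lenP betaE k.
(* With m the induced matching number, 2m - (m - s) = m + s; [s_le] makes the truncated subtraction
   exact. *)
by exists r => //; apply: le_trans le_r; move: deg_k s_le; lia.
Qed.
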